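(* Let $\gamma$ be a positive integer, $P_0$ a continuous distribution on $\mathbb{R}^n$ with density $p_0$, $\varepsilon\ge0$, and $\tilde{\mathcal{P}}$ a class of distributions on $\mathbb{R}^n$ with $N_\gamma(P_0)\subseteq\tilde{\mathcal{P}}$. For $P\in N_\gamma(P_0)$ with density $p$, let $\mathbf{Q}^\star_\varepsilon(P)$ be the distribution with density \[ q(x)=\mathrm{clip}\Big(\tfrac{1}{r_P}p(x);\ \tfrac{\gamma+1}{\gamma+e^\varepsilon}p_0(x),\ \tfrac{(\gamma+1)e^\varepsilon}{\gamma+e^\varepsilon}p_0(x)\Big), \] where $r_P>0$ is the normalizing constant making $\int q=1$. Fix an $f$-divergence $D_f$ and define $\mathbf{Q}^\star_{\varepsilon,N_\gamma(P_0)}(P)=\mathbf{Q}^\star_\varepsilon(P)$ if $P\in N_\gamma(P_0)$ and $=\mathbf{Q}^\star_\varepsilon(\hat P)$ otherwise, where $\hat P\in N_\gamma(P_0)$ minimizes $D_f(P\|P')$ over $P'\in N_\gamma(P_0)$. Then $\mathbf{Q}^\star_{\varepsilon,N_\gamma(P_0)}\in\mathcal{Q}_{\mathbb{R}^n,\tilde{\mathcal{P}},\varepsilon}$ and \[ \sup_{P\in N_\gamma(P_0)}D_f\big(P\|\mathbf{Q}^\star_{\varepsilon,N_\gamma(P_0)}(P)\big)=\mathcal{R}\big(\mathcal{Q}_{\mathbb{R}^n,\tilde{\mathcal{P}},\varepsilon},N_\gamma(P_0),f\big). \]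
   Context: $\mathrm{clip}(x;s_1,s_2)=\max\{s_1,\min\{s_2,x\}\}$. For $\gamma\ge1$, $E_\gamma(P\|Q)=\mathbb{E}_Q[\max\{\frac{dP}{dQ}-\gamma,0\}]$ and $N_\gamma(P_0)=\{P:E_\gamma(P\|P_0)=E_\gamma(P_0\|P)=0\}$, equivalently the $P\ll P_0$ with $\frac1\gamma\le\frac{dP}{dP_0}\le\gamma$. A sampler $\mathbf{Q}:\tilde{\mathcal{P}}\to\mathcal{P}(\mathbb{R}^n)$ is $\varepsilon$-LDP if $\mathbf{Q}(P)(A)\le e^\varepsilon\mathbf{Q}(P')(A)$ for all $P,P'\in\tilde{\mathcal{P}}$ and measurable $A$; $\mathcal{Q}_{\mathbb{R}^n,\tilde{\mathcal{P}},\varepsilon}$ is the set of such samplers. $D_f(P\|Q)=\int qf(p/q)$ for convex $f:(0,\infty)\to\mathbb{R}$, $f(1)=0$ (conventions $f(0)=\lim_{t\to0^+}f(t)$, $0f(0/0)=0$, $0f(a/0)=a\lim_{u\to\infty}f(u)/u$). $\mathcal{R}(\mathcal{Q}_{\mathbb{R}^n,\tilde{\mathcal{P}},\varepsilon},N_\gamma(P_0),f)=\inf_{\mathbf{Q}\in\mathcal{Q}_{\mathbb{R}^n,\tilde{\mathcal{P}},\varepsilon}}\sup_{P\in N_\gamma(P_0)}D_f(P\|\mathbf{Q}(P))$. *)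

(* Defs.v *)
From HB Require Import structures.
From mathcomp Require Import all_boot all_order all_algebra.
From mathcomp Require Import all_classical all_reals all_analysis.
Set Implicit Arguments. Unset Strict Implicit. Unset Printing Implicit Defensive.
Import Order.TTheory GRing.Theory Num.Theory.
Import numFieldNormedType.Exports.
Local Open Scope classical_set_scope.
Local Open Scope ring_scope.

Section Defs.
Context {R : realType} {n : nat}.
Local Notation T := (n.-tuple R).
Local Notation prob := (probability T R).

Definition clip (x s1 s2 : R) : R := Num.max s1 (Num.min s2 x).

(* lam is Lebesgue measure on R^n: the volume of every box is the product of
   its side lengths (this determines lam uniquely on the Borel sets). *)
Definition is_lebesgue_tuple (lam : {measure set T -> \bar R}) : Prop :=
  forall a b : T, (forall i, tnth a i <= tnth b i) ->
    lam [set x | forall i, tnth a i < tnth x i <= tnth b i]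
      = (\prod_(i < n) (tnth b i - tnth a i))%:E.

Definition is_density (mu : {measure set T -> \bar R})
    (P : set T -> \bar R) (p : T -> R) : Prop :=
  [/\ measurable_fun setT p, (forall x, 0 <= p x) &
      forall A, measurable A -> P A = (\int[mu]_(x in A) (p x)%:E)%E].

Definition fdiv_generator (f : R -> R) : Prop :=
  (forall x y t, 0 < x -> 0 < y -> 0 <= t <= 1 ->
     f (t * x + (1 - t) * y) <= t * f x + (1 - t) * f y) /\ f 1 = 0.

Definition f_at0 (f : R -> R) : \bar R := lim ((fun t => (f t)%:E) @ 0^'+).
Definition f_slope_inf (f : R -> R) : \bar R :=
  lim ((fun u => (f u / u)%:E) @ +oo).

(* the integrand q f(p/q), with 0 f(0/0) = 0 and 0 f(a/0) = a lim f(u)/u *)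
Definition fdiv_integrand (f : R -> R) (p q : R) : \bar R :=
  if 0 < q then
    (if 0 < p then (q * f (p / q))%:E else (q%:E * f_at0 f)%E)
  else if 0 < p then (p%:E * f_slope_inf f)%E else 0%E.

(* D_f(P||Q) = \int q f(p/q) dmu for any measure mu dominating P and Q, with
   p = dP/dmu, q = dQ/dmu (the value does not depend on the choice). *)
Definition Df (f : R -> R) (P Q : prob) : \bar R :=
  ereal_inf [set v | exists (mu : {measure set T -> \bar R}) (p q : T -> R),
    [/\ is_density mu P p, is_density mu Q q &
        v = (\int[mu]_x fdiv_integrand f (p x) (q x))%E]].

Definition Egamma (gamma : R) (P Q : prob) : \bar R :=
  Df (fun t => Num.max (t - gamma) 0) P Q.

Definition Ngamma (gamma : R) (P0 : prob) : set prob :=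
  [set P | Egamma gamma P P0 = 0%E /\ Egamma gamma P0 P = 0%E].

Definition is_LDP_sampler (Pt : set prob) (eps : R) (Q : prob -> prob) : Prop :=
  forall P P', Pt P -> Pt P' -> forall A, measurable A ->
    (Q P A <= (expR eps)%:E * Q P' A)%E.

Definition minimax_risk (Pt : set prob) (eps : R) (N : set prob)
    (f : R -> R) : \bar R :=
  ereal_inf [set v | exists Q : prob -> prob, is_LDP_sampler Pt eps Q /\
    v = ereal_sup [set Df f P (Q P) | P in N]].

End Defs.

(* Main.v *)
(** Idea. Every [P] in [N_gamma(P0)] has a [P0]-density with values in [[1/gamma, gamma]],
    so the whole problem lives over [P0]. Write [e = exp eps].
    - Lower bound: [P0] is atomless, so [R^n] splits into [gamma + 1] cells [A_i] of equal
      [P0]-mass. Let [P_i] have density [gamma] on [A_i] and [1/gamma] elsewhere; this is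
      where [gamma] must be an integer. Privacy forces some [i] with
      [Q(P_i)(A_i) <= e / (gamma + e)], whereas [P_i(A_i) = gamma / (gamma + 1)]. Bounding
      [f] below by one tangent on [A_i] and another one off [A_i] turns this into a lower
      bound on [D_f(P_i || Q(P_i))], with no case distinction on vanishing densities.
    - Upper bound: when [e < gamma^2] the density ratio [p / q] of the clipped sampler stays
      in the interval [[t2, t1]] spanned by the two ratios of the extremal pair above.
      Bounding [f] by its chord on [[t2, t1]] gives the same value.
    - When [e >= gamma^2] clipping is inactive and the sampler returns [P] itself.
    Both bounds compare integrands pointwise with affine functions of [(p, q)], so the
    measurability of the [f]-divergence integrand never matters. *)
Require Import Defs.
From HB Require Import structures.
From mathcomp Require Import all_boot all_order all_algebra.
From mathcomp Require Import all_classical all_reals all_analysis.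
From mathcomp Require Import measurable_realfun ring lra.
Import Order.TTheory GRing.Theory Num.Theory.
Import numFieldNormedType.Exports HBNNSimple.
Set Implicit Arguments. Unset Strict Implicit. Unset Printing Implicit Defensive.
Local Open Scope classical_set_scope.
Local Open Scope ring_scope.

(** * Integration *)

(** For nonnegative functions the integral is a supremum over the simple functions lying below, so
    enlarging the function enlarges the family. The signed case splits into positive and negative
    parts. *)
Lemma le_integral_pointwise d (T : measurableType d) (R : realType)
    (mu : {measure set T -> \bar R}) (f g : T -> \bar R) :
  (forall x, f x <= g x)%E -> (\int[mu]_x f x <= \int[mu]_x g x)%E.
Proof.
move=> fg.
have H (u v : T -> \bar R) : (forall x, 0 <= u x)%E -> (forall x, u x <= v x)%E ->
    (\int[mu]_x u x <= \int[mu]_x v x)%E.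
  move=> u0 uv; have v0 x : (0 <= v x)%E := le_trans (u0 x) (uv x).
  rewrite !ge0_integralTE//; apply: ge_ereal_sup => _ [h /= hu <-].
  by apply: ereal_sup_ubound; exists h => //= x; exact: le_trans (hu x) (uv x).
rewrite integralE [leRHS]integralE; apply: leeB; apply: H => // x;
  rewrite ?funeposE ?funenegE ge_max !le_max lexx orbT andbT ?leeN2 fg//.
Qed.

(** Change of measure: linearity settles simple functions, and monotone convergence along
    [nnsfun_approx] carries the identity to [g]. *)
Lemma integral_density d (T : measurableType d) (R : realType)
    (mu nu : {measure set T -> \bar R}) (p g : T -> R) (E : set T) :
  measurable_fun setT p -> (forall x, 0 <= p x) ->
  (forall A, measurable A -> nu A = \int[mu]_(x in A) (p x)%:E)%E ->
  measurable_fun setT g -> (forall x, 0 <= g x) -> measurable E ->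
  (\int[nu]_(x in E) (g x)%:E = \int[mu]_(x in E) (p x * g x)%:E)%E.
Proof.
move=> mp p0 nuE mg g0 mE.
pose f : T -> \bar R := EFin \o g.
have mf : measurable_fun E f by exact/measurable_funTS/measurable_EFinP.
have f0 x : (0 <= f x)%E by rewrite lee_fin.
pose h := nnsfun_approx mE mf.
have hg x : E x -> (h n x)%:E @[n --> \oo] --> (g x)%:E.
  by move=> Ex; exact: (cvg_nnsfun_approx mE mf (fun x _ => f0 x) Ex).
have mh n : measurable_fun E (fun x => (h n x)%:E).
  by apply: measurable_funTS; exact/measurable_EFinP.
have hnd x : E x -> {homo (fun n => h n x) : m n / (m <= n)%N >-> m <= n}.
  by move=> Ex a b ab; exact/lefP/nd_nnsfun_approx.
have -> : (\int[nu]_(x in E) (g x)%:E =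
    lim (\int[nu]_(x in E) (h n x)%:E @[n --> \oo]))%E.
  rewrite -(@monotone_convergence _ _ _ nu E mE (fun n x => (h n x)%:E) mh).
  - by apply: eq_integral => x; rewrite inE => Ex; apply/esym/cvg_lim => //; exact: hg.
  - by move=> n x _; rewrite lee_fin.
  - by move=> x Ex a b ab; rewrite lee_fin hnd.
have mph n : measurable_fun E (fun x => (p x * h n x)%:E).
  by apply: measurable_funTS; apply/measurable_EFinP; exact: measurable_funM.
have -> : (\int[mu]_(x in E) (p x * g x)%:E =
    lim (\int[mu]_(x in E) (p x * h n x)%:E @[n --> \oo]))%E.
  rewrite -(@monotone_convergence _ _ _ mu E mE (fun n x => (p x * h n x)%:E) mph).
  - apply: eq_integral => x; rewrite inE => Ex; apply/esym/cvg_lim => //.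
    have -> : (p x * g x)%:E = ((p x)%:E * (g x)%:E)%E by rewrite EFinM.
    have -> : (fun n => (p x * h n x)%:E) = (fun n => (p x)%:E * (h n x)%:E)%E.
      by apply/funext => n; rewrite EFinM.
    have px : (p x)%:E \is a fin_num by [].
    exact: (cvgeZl px (hg x Ex)).
  - by move=> n x _; rewrite lee_fin; apply: mulr_ge0.
  - by move=> x Ex a b ab; rewrite lee_fin ler_wpM2l// hnd.
congr (lim (_ @ \oo)); apply/funext => n.
transitivity (\int[nu]_(x in E)
   (\sum_(y \in range (h n)) (y * \1_(h n @^-1` [set y]) x)%:E))%E.
  by apply: eq_integral => t tE; rewrite fimfunE -fsumEFin.
have mindic r : measurable_fun setT (fun x => r * \1_(h n @^-1` [set r]) x).
  by apply: measurable_funM.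
have ind0 r x : 0 <= r * \1_(h n @^-1` [set r]) x.
  by rewrite -lee_fin EFinM nnfun_muleindic_ge0.
rewrite ge0_integral_fsum//; last 2 first.
- by move=> r; apply: measurable_funTS; exact/measurable_EFinP.
- by move=> r x _; rewrite lee_fin.
transitivity (\sum_(y \in range (h n))
   \int[mu]_(x in E) (p x * (y * \1_(h n @^-1` [set y]) x))%:E)%E; last first.
  rewrite -ge0_integral_fsum//; last 2 first.
  - by move=> r; apply: measurable_funTS; apply/measurable_EFinP; exact: measurable_funM.
  - by move=> r x _; rewrite lee_fin; apply: mulr_ge0.
  apply: eq_integral => x _; rewrite [in RHS]fimfunE.
  rewrite fsumEFin//; congr EFin.
  rewrite !fsbig_finite//= mulr_sumr; apply: eq_bigr => //.
apply: eq_fsbigr => y; rewrite inE => -[z _ <-].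
have hz : 0 <= h n z by [].
have mH : measurable (h n @^-1` [set h n z]) by [].
under eq_integral do rewrite EFinM.
rewrite ge0_integralZl//; last by apply: measurable_funTS; exact/measurable_EFinP.
rewrite integral_indic// nuE; last exact: measurableI.
under [RHS]eq_integral do rewrite mulrCA EFinM.
rewrite ge0_integralZl//; last 2 first.
- by apply: measurable_funTS; apply/measurable_EFinP; exact: measurable_funM.
- by move=> x _; rewrite lee_fin; apply: mulr_ge0.
congr (_ * _)%E; rewrite setIC integral_mkcondr; apply: eq_integral => x _.
by rewrite patchE indicE; case: ifPn; rewrite ?mulr1 ?mulr0.
Qed.

(** * Convex generators *)

Section generator.
Context {R : realType} (f : R -> R).
Hypothesis genf : fdiv_generator f.

(** As [f 1 = 0], the quotient is the slope of the chord from 1, which convexity makes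
    nondecreasing. This lemma and its mirror below 1 yield the limits used where a density
    vanishes. *)
Lemma fdiv_generator_slope_gt1 u v : 1 < u -> u <= v -> f u / (u - 1) <= f v / (v - 1).
Proof.
case: genf => cf f1 u1 uv.
have := cf v 1 ((u - 1) / (v - 1)).
rewrite f1 mulr0 addr0 (_ : _ * v + _ = u); last by field; lra.
move=> /(_ ltac:(lra) ltac:(lra)) H.
rewrite ler_pdivrMr ?subr_gt0//.
apply: (le_trans (H _)); first by rewrite divr_ge0 ?ler_pdivrMr; lra.
by rewrite le_eqVlt; apply/orP; left; apply/eqP; ring.
Qed.

Lemma fdiv_generator_slope_lt1 u v : 0 < u -> u <= v -> v < 1 ->
  f u / (u - 1) <= f v / (v - 1).
Proof.
case: genf => cf f1 u0 uv v1.
have := cf u 1 ((1 - v) / (1 - u)).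
rewrite f1 mulr0 addr0 (_ : _ * u + _ = v); last by field; lra.
move=> /(_ ltac:(lra) ltac:(lra)) H.
have {}H : f v <= (1 - v) / (1 - u) * f u.
  by apply: H; rewrite divr_ge0 ?ler_pdivrMr; lra.
rewrite ler_ndivlMr ?subr_lt0//.
apply: (le_trans H); rewrite le_eqVlt; apply/orP; left; apply/eqP.
by field; lra.
Qed.

Lemma is_cvg_f_slope_inf : cvg ((fun u => (f u / u)%:E) @ +oo%R).
Proof.
(* The cut at 2 keeps the chord slope away from its pole and makes it monotone on the whole line;
   [f u / u] is this slope times [1 - 1 / u]. *)
pose g (u : R) := (f (Num.max u 2) / (Num.max u 2 - 1))%:E.
have ndg : nondecreasing_fun g.
  move=> u v uv; rewrite lee_fin; apply: fdiv_generator_slope_gt1.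
    by rewrite lt_max; apply/orP; right; lra.
  by rewrite ge_max !le_max uv lexx orbT.
have gL := nondecreasing_cvge ndg.
have h1 : (fun u : R => (1 - u^-1)%:E) @ +oo%R --> 1%:E.
  apply: cvg_EFin; first exact: nearW.
  rewrite -[X in _ --> X]subr0; apply: cvgB; first exact: cvg_cst.
  apply/(gtr0_cvgV0 (f := fun u : R => u)); last exact: cvg_id.
  exact: nbhs_pinfty_gt.
apply/cvg_ex; exists (ereal_sup (range g) * 1%:E)%E.
apply: cvg_trans (cvgeM _ gL h1); last by case: (ereal_sup _) => [r||] //=; rewrite /mule_def oner_eq0.
apply: near_eq_cvg; near=> u.
have u2 : 2 <= u by near: u; exact: nbhs_pinfty_ge.
rewrite /g/= max_l// -EFinM; congr EFin; field.
by apply/andP; split; apply/eqP; lra.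
Unshelve. all: by end_near. Qed.

Lemma is_cvg_f_at0 : cvg ((fun t => (f t)%:E) @ (0:R)^'+).
Proof.
have : cvg ((fun t => (f t / (t - 1))%:E) @ (0:R)^'+).
  apply: nondecreasing_at_right_is_cvge; near=> x => u v.
  rewrite !in_itv/= => /andP[u0 ux] /andP[v0 vx] uv; rewrite lee_fin.
  apply: fdiv_generator_slope_lt1 => //; apply: (lt_trans vx).
  by near: x; exact: nbhs_right_lt.
move=> /cvg_ex[L gL].
have h1 : (fun t : R => (t - 1)%:E) @ (0:R)^'+ --> (-1)%:E.
  apply: cvg_EFin; first exact: nearW.
  rewrite -[X in _ --> X]sub0r; apply: cvgB; last exact: cvg_cst.
  by apply: cvg_at_right_filter; exact: cvg_id.
apply/cvg_ex; exists (L * (-1)%:E)%E.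
apply: cvg_trans (cvgeM _ gL h1); last by case: L {gL} => [r||] //=; rewrite /mule_def oppr_eq0 oner_eq0.
apply: near_eq_cvg; near=> t.
have t1 : t < 1 by near: t; exact: nbhs_right_lt.
by rewrite /= -EFinM; congr EFin; field; lra.
Unshelve. all: by end_near. Qed.

Lemma f_slope_inf_ge (a s : R) : (forall t, 0 < t -> a + s * t <= f t) ->
  (s%:E <= f_slope_inf f)%E.
Proof.
move=> H; apply/lee_subgt0Pr => e e0.
apply: lime_ge; first exact: is_cvg_f_slope_inf.
near=> u; rewrite lee_fin.
have u0 : 0 < u by near: u; exact: nbhs_pinfty_gt.
have ue : `|a| / e <= u by near: u; apply: nbhs_pinfty_ge; exact: num_real.
rewrite ler_pdivlMr//; apply: le_trans (H _ u0).
rewrite ler_pdivrMr// in ue; have := ler_norm (- a); rewrite normrN; lra.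
Unshelve. all: by end_near. Qed.

Lemma f_at0_ge (a s : R) : (forall t, 0 < t -> a + s * t <= f t) ->
  (a%:E <= f_at0 f)%E.
Proof.
move=> H; apply/lee_subgt0Pr => e e0.
apply: lime_ge; first exact: is_cvg_f_at0.
near=> u; rewrite lee_fin.
have u0 : 0 < u by near: u; exact: nbhs_right_gt.
have s1 : 0 < `|s| + 1 by rewrite ltr_wpDl.
have ue : u <= e / (`|s| + 1) by near: u; apply: nbhs_right_le; exact: divr_gt0.
apply: le_trans (H _ u0).
rewrite ler_pdivlMr// in ue; have := ler_norm (- s); rewrite normrN; nra.
Unshelve. all: by end_near. Qed.

(** For positive [p] and [q], evaluate the affine minorant at [p / q] and multiply by [q]; where one
    of them vanishes, the limit of the minorant takes over. *)
Lemma fdiv_integrand_ge (a s p q : R) : (forall t, 0 < t -> a + s * t <= f t) ->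
  0 <= p -> 0 <= q -> ((a * q + s * p)%:E <= fdiv_integrand f p q)%E.
Proof.
move=> H p0 q0; rewrite /fdiv_integrand.
have [q1|q1] := ltP 0 q; last first.
  have -> : q = 0 by apply/eqP; rewrite eq_le q0 q1.
  rewrite mulr0 add0r; have [p1|p1] := ltP 0 p.
    by rewrite EFinM muleC lee_wpmul2l//; first exact: f_slope_inf_ge H.
  have -> : p = 0 by apply/eqP; rewrite eq_le p0 p1.
  by rewrite mulr0.
have [p1|p1] := ltP 0 p.
  rewrite lee_fin; apply: le_trans (_ : q * (a + s * (p / q)) <= _).
    by rewrite le_eqVlt; apply/orP; left; apply/eqP; field; lra.
  by rewrite ler_pM2l// H// divr_gt0.
have -> : p = 0 by apply/eqP; rewrite eq_le p0 p1.
by rewrite mulr0 addr0 EFinM muleC; apply: lee_wpmul2l => //; exact: f_at0_ge H.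
Qed.

Lemma fdiv_generator_tangent (t : R) : 0 < t ->
  exists s : R, forall u, 0 < u -> f t + s * (u - t) <= f u.
Proof.
case: genf => cf _ t0.
(* Slopes of chords arriving at [t] from the left. Every chord slope leaving [t] to the right bounds
   them, so their supremum is a subgradient. *)
pose S := [set (f t - f z) / (t - z) | z in [set z : R | 0 < z < t]].
have ub y : t < y -> ubound S ((f y - f t) / (y - t)).
  move=> ty _ [z /andP[z0 zt] <-].
  have := cf z y ((y - t) / (y - z)).
  rewrite (_ : _ * z + _ = t); last by field; lra.
  move=> /(_ ltac:(lra) ltac:(lra)) H.
  have {}H : f t <= (y - t) / (y - z) * f z + (1 - (y - t) / (y - z)) * f y.
    by apply: H; rewrite divr_ge0 ?ler_pdivrMr; lra.
  have yz : 0 < y - z by lra.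
  have {}H : (y - z) * f t <= (y - t) * f z + (t - z) * f y.
    rewrite -(ler_pM2l yz) in H; apply: (le_trans H).
    by rewrite le_eqVlt; apply/orP; left; apply/eqP; field; lra.
  rewrite ler_pdivrMr ?subr_gt0// mulrAC ler_pdivlMr ?subr_gt0//; lra.
have hS : has_sup S.
  split; first by exists ((f t - f (t / 2)) / (t - t / 2)), (t / 2) => //=; lra.
  by exists ((f (t + 1) - f t) / (t + 1 - t)); apply: ub; lra.
exists (sup S) => u u0; have [ut|tu|->] := ltgtP u t; last by rewrite subrr mulr0 addr0.
- have : (f t - f u) / (t - u) <= sup S.
    by apply: sup_upper_bound => //; exists u => //=; rewrite u0.
  rewrite ler_pdivrMr ?subr_gt0//; lra.
- have : sup S <= (f u - f t) / (u - t) by apply: sup_le_ub => //; [exact: hS.1|exact: ub].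
  rewrite ler_pdivlMr ?subr_gt0//; lra.
Qed.

End generator.

(** * Bounds on f-divergences and the class Ngamma *)

Lemma integral_setIC d (T : measurableType d) (R : realType)
    (mu : {measure set T -> \bar R}) (A B : set T) (h : T -> \bar R) :
  measurable A -> measurable B -> measurable_fun A h ->
  (\int[mu]_(x in A) h x = \int[mu]_(x in A `&` B) h x + \int[mu]_(x in A `&` ~` B) h x)%E.
Proof.
move=> mA mB mh; rewrite -{1}[A](setUIDK A B) setDE integral_setU//.
- exact: measurableI.
- by apply: measurableI => //; exact: measurableC.
- by rewrite -setDE setUIDK.
- by apply/disj_setPS => x [[_ ?] [_ ?]].
Qed.

Section Df_bounds.
Context {R : realType} {n : nat}.
Local Notation T := (n.-tuple R).
Local Notation prob := (probability T R).
Implicit Types (mu : {measure set T -> \bar R}) (P Q : prob) (p q : T -> R).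

Lemma density_integrable mu P p : is_density mu P p -> mu.-integrable setT (EFin \o p).
Proof.
case=> mp p0 Pp; apply/integrableP; split; first exact/measurable_EFinP.
under eq_integral do rewrite /= ger0_norm//.
by rewrite -Pp// probability_setT ltry.
Qed.

Lemma integral_affine_density mu P Q p q (a s : R) (A : set T) :
  is_density mu P p -> is_density mu Q q -> measurable A ->
  (\int[mu]_(x in A) (a * q x + s * p x)%:E
   = (a * fine (Q A) + s * fine (P A))%:E)%E.
Proof.
move=> dP dQ mA.
have iP : mu.-integrable A (EFin \o p).
  exact: integrableS (density_integrable dP).
have iQ : mu.-integrable A (EFin \o q).
  exact: integrableS (density_integrable dQ).
transitivity (\int[mu]_(x in A) (a%:E * (EFin \o q) x + s%:E * (EFin \o p) x))%E.
  by apply: eq_integral => x _; rewrite EFinD !EFinM.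
rewrite integralD//; [|exact: integrableZl..].
rewrite !integralZl// EFinD !EFinM !fineK ?fin_num_measure//.
by case: dP => _ _ ->//; case: dQ => _ _ ->.
Qed.

(** One affine minorant on [A] and another off [A] integrate to a quantity that depends only on the
    masses of [A] and its complement. It is thus the same for every dominating measure and bounds
    the infimum. *)
Lemma Df_ge (f : R -> R) P Q (A : set T) (a1 s1 a2 s2 : R) :
  fdiv_generator f -> measurable A ->
  (forall t, 0 < t -> a1 + s1 * t <= f t) ->
  (forall t, 0 < t -> a2 + s2 * t <= f t) ->
  ((a1 * fine (Q A) + s1 * fine (P A)
    + (a2 * fine (Q (~` A)) + s2 * fine (P (~` A))))%:E <= Df f P Q)%E.
Proof.
move=> gf mA h1 h2; apply: le_ereal_inf_tmp => _ [mu [p [q [dP dQ ->]]]].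
have mCA : measurable (~` A) by exact: measurableC.
have [mp p0 _] := dP; have [mq q0 _] := dQ.
rewrite EFinD -(integral_affine_density a1 s1 dP dQ mA).
rewrite -(integral_affine_density a2 s2 dP dQ mCA).
pose l x := (if x \in A then a1 * q x + s1 * p x else a2 * q x + s2 * p x)%:E.
have lA : {in A, l =1 fun x => (a1 * q x + s1 * p x)%:E}.
  by move=> x xA; rewrite /l xA.
have lCA : {in ~` A, l =1 fun x => (a2 * q x + s2 * p x)%:E}.
  by move=> x; rewrite in_setC /l => /negbTE ->.
have mlin a s (B : set T) : measurable_fun B (fun x => (a * q x + s * p x)%:E).
  apply: measurable_funTS; apply/measurable_EFinP.
  by apply: measurable_funD; exact: measurable_funM.
rewrite -(eq_integral _ _ lA) -(eq_integral _ _ lCA).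
rewrite -integral_setU ?setUv//; last 2 first.
- rewrite -[X in measurable_fun X](setUv A); apply/(measurable_funU _ mA mCA); split.
    by apply: eq_measurable_fun (mlin a1 s1 A) => x xA; rewrite lA.
  by apply: eq_measurable_fun (mlin a2 s2 (~` A)) => x xA; rewrite lCA.
- by apply/disj_setPS => x [].
apply: le_integral_pointwise => x; rewrite /l.
by case: ifP => _; exact: fdiv_integrand_ge.
Qed.

Lemma Df_ge0 (f : R -> R) P Q : fdiv_generator f -> (0 <= Df f P Q)%E.
Proof.
move=> gf; have [s hs] := fdiv_generator_tangent gf (@ltr01 R).
have hs' t : 0 < t -> - s + s * t <= f t.
  by move=> /hs; rewrite gf.2; lra.
have := Df_ge P Q gf (@measurableT _ T) hs' hs'.
by rewrite setCT !measure0 !probability_setT/= !mulr0 !addr0 !mulr1 addNr.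
Qed.

Lemma Df_le (f : R -> R) mu P Q p q (a s : R) :
  is_density mu P p -> is_density mu Q q ->
  (forall x, (fdiv_integrand f (p x) (q x) <= (a * q x + s * p x)%:E)%E) ->
  (Df f P Q <= (a + s)%:E)%E.
Proof.
move=> dP dQ h.
apply: (@le_trans _ _ (\int[mu]_x fdiv_integrand f (p x) (q x))%E).
  by apply: ereal_inf_lbound; exists mu, p, q.
apply: (le_trans (le_integral_pointwise mu h)).
by rewrite (integral_affine_density _ _ dP dQ)// !probability_setT !mulr1.
Qed.

Lemma eq_Df (f : R -> R) P Q Q' : (forall A, measurable A -> Q A = Q' A) ->
  Df f P Q = Df f P Q'.
Proof.
move=> QQ'; congr ereal_inf; apply/seteqP.
by split=> v [mu [p [q [dP [mq q0 dQ] ->]]]]; exists mu, p, q; split => //;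
  split => // A mA; rewrite -dQ// QQ'.
Qed.

Lemma fdiv_generator_hinge (gamma : R) : 1 <= gamma ->
  fdiv_generator (fun t => Num.max (t - gamma) 0).
Proof.
move=> g1; split; last by rewrite max_r//; lra.
move=> x y t x0 y0 /andP[t0 t1].
have xm : x - gamma <= Num.max (x - gamma) 0 by rewrite le_max lexx.
have ym : y - gamma <= Num.max (y - gamma) 0 by rewrite le_max lexx.
have x0' : 0 <= Num.max (x - gamma) 0 by rewrite le_max lexx orbT.
have y0' : 0 <= Num.max (y - gamma) 0 by rewrite le_max lexx orbT.
by rewrite ge_max; apply/andP; split; nra.
Qed.

Lemma density_id P : is_density P P (cst 1).
Proof.
split; [exact: measurable_cst|by move=> x; rewrite ler01|move=> A mA].
by rewrite (integral_cst P mA 1%:E) mul1e.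
Qed.

(** The hinge dominates both [t - gamma] and 0; using the first on [A] and the second off [A] bounds
    [P A - gamma * Q A] by the divergence. *)
Lemma Egamma0_le (gamma : R) P Q (A : set T) : 1 <= gamma -> measurable A ->
  Egamma gamma P Q = 0%E -> fine (P A) <= gamma * fine (Q A).
Proof.
move=> g1 mA E0.
have h1 t : 0 < t -> - gamma + 1 * t <= Num.max (t - gamma) 0.
  by move=> _; rewrite le_max; apply/orP; left; lra.
have h2 t : 0 < t -> 0 + 0 * t <= Num.max (t - gamma) 0.
  by move=> _; rewrite le_max mul0r addr0 lexx orbT.
have := Df_ge P Q (fdiv_generator_hinge g1) mA h1 h2.
rewrite -/(Egamma _ _ _) E0 lee_fin; lra.
Qed.

Lemma Egamma_density_eq0 (gamma : R) mu P Q p q : 1 <= gamma ->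
  is_density mu P p -> is_density mu Q q ->
  (forall x, 0 < p x) -> (forall x, 0 < q x) -> (forall x, p x <= gamma * q x) ->
  Egamma gamma P Q = 0%E.
Proof.
move=> g1 dP dQ p0 q0 pq; apply/eqP; rewrite eq_le; apply/andP; split; last first.
  exact/Df_ge0/fdiv_generator_hinge.
have <- : (0 + 0 : R)%:E = 0%E by rewrite addr0.
apply: (Df_le dP dQ) => x; rewrite /fdiv_integrand q0 p0 !mul0r addr0 lee_fin.
by rewrite max_r ?mulr0// subr_le0 ler_pdivrMr.
Qed.

Lemma Ngamma_density (gamma : R) (P0 P : prob) g : 1 <= gamma ->
  is_density P0 P g -> (forall x, gamma^-1 <= g x <= gamma) -> Ngamma gamma P0 P.
Proof.
move=> g1 dP hg; have gm0 : 0 < gamma by lra.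
have g0 x : 0 < g x.
  by have /andP[+ _] := hg x; apply: lt_le_trans; rewrite invr_gt0.
split.
- apply: (Egamma_density_eq0 g1 dP (density_id P0)) => // x.
  by rewrite mulr1; case/andP: (hg x).
- apply: (Egamma_density_eq0 g1 (density_id P0) dP) => // x.
  by have /andP[+ _] := hg x; rewrite -(ler_pM2l gm0) mulfV// gt_eqF.
Qed.

(** On the set where [p] exceeds [c], the setwise bound gives [P] at most [c] times the [P0]-mass,
    so truncation loses nothing. This turns a setwise bound into one that holds at every point. *)
Lemma density_min (P0 P : prob) p (c : R) : 0 <= c ->
  is_density P0 P p -> (forall A, measurable A -> (P A <= c%:E * P0 A)%E) ->
  is_density P0 P (fun x => Num.min (p x) c).
Proof.
move=> c0 [mp p0 Pp] Pc.
have mh : measurable_fun setT (fun x => Num.min (p x) c).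
  exact: measurable_minr.
have h0 x : 0 <= Num.min (p x) c by rewrite le_min p0.
split=> // A mA; apply/eqP; rewrite eq_le; apply/andP; split; last first.
  rewrite Pp//; apply: ge0_le_integral => //.
  - by move=> x _; rewrite lee_fin.
  - by apply: measurable_funTS; exact/measurable_EFinP.
  - by apply: measurable_funTS; exact/measurable_EFinP.
  - by move=> x _; rewrite lee_fin ge_min lexx.
pose B := [set x | p x <= c].
have mB : measurable B.
  by rewrite -[B]setTI; exact: measurable_fun_ler.
have mAB : measurable (A `&` B) by exact: measurableI.
have mACB : measurable (A `&` ~` B) by apply: measurableI => //; exact: measurableC.
rewrite (integral_setIC _ mA mB); last by apply: measurable_funTS; exact/measurable_EFinP.
have -> : P A = (P (A `&` B) + P (A `&` ~` B))%E.
  rewrite -[in LHS](setUIDK A B) setDE measureU//.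
  by rewrite -subset0 => x [[_ ?] [_ ?]].
apply: leeD.
  rewrite Pp// le_eqVlt; apply/orP; left; apply/eqP; apply: eq_integral => x.
  by rewrite inE => -[_ Bx]; rewrite min_l.
apply: le_trans (Pc _ mACB) _; rewrite -integral_cst//.
rewrite le_eqVlt; apply/orP; left; apply/eqP; apply: eq_integral => x.
by rewrite inE => -[_ /negP]; rewrite -ltNge => /ltW Bx; rewrite min_r.
Qed.

Lemma density_max (P0 P : prob) p (c : R) : 0 <= c ->
  is_density P0 P p -> (forall A, measurable A -> (c%:E * P0 A <= P A)%E) ->
  is_density P0 P (fun x => Num.max (p x) c).
Proof.
move=> c0 [mp p0 Pp] Pc.
have mh : measurable_fun setT (fun x => Num.max (p x) c).
  exact: measurable_maxr.
have h0 x : 0 <= Num.max (p x) c by rewrite le_max p0.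
split=> // A mA; apply/eqP; rewrite eq_le; apply/andP; split.
  rewrite Pp//; apply: ge0_le_integral => //.
  - by move=> x _; rewrite lee_fin.
  - by apply: measurable_funTS; exact/measurable_EFinP.
  - by apply: measurable_funTS; exact/measurable_EFinP.
  - by move=> x _; rewrite lee_fin le_max lexx.
pose B := [set x | c <= p x].
have mB : measurable B.
  by rewrite -[B]setTI; exact: measurable_fun_ler.
have mAB : measurable (A `&` B) by exact: measurableI.
have mACB : measurable (A `&` ~` B) by apply: measurableI => //; exact: measurableC.
rewrite (integral_setIC _ mA mB); last by apply: measurable_funTS; exact/measurable_EFinP.
have -> : P A = (P (A `&` B) + P (A `&` ~` B))%E.
  rewrite -[in LHS](setUIDK A B) setDE measureU//.
  by rewrite -subset0 => x [[_ ?] [_ ?]].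
apply: leeD.
  rewrite Pp// le_eqVlt; apply/orP; left; apply/eqP; apply: eq_integral => x.
  by rewrite inE => -[_ Bx]; rewrite max_l.
apply: le_trans (Pc _ mACB); rewrite -integral_cst//.
rewrite le_eqVlt; apply/orP; left; apply/eqP; apply: eq_integral => x.
by rewrite inE => -[_ /negP]; rewrite -ltNge => /ltW Bx; rewrite max_r.
Qed.

(** The two vanishing divergences give setwise bounds, hence a Radon-Nikodym derivative; truncating
    it above and below makes the bounds hold everywhere, as the pointwise comparisons later
    require. *)
Lemma Ngamma_density_ex (gamma : R) (P0 P : prob) : 1 <= gamma ->
  Ngamma gamma P0 P ->
  exists g, is_density P0 P g /\ forall x, gamma^-1 <= g x <= gamma.
Proof.
move=> g1 [E1 E2].
have gm0 : 0 < gamma by lra.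
have le1 A : measurable A -> (P A <= gamma%:E * P0 A)%E.
  move=> mA; have := Egamma0_le g1 mA E1.
  by rewrite -lee_fin EFinM !fineK ?fin_num_measure.
have le2 A : measurable A -> ((gamma^-1)%:E * P0 A <= P A)%E.
  move=> mA; have := Egamma0_le g1 mA E2.
  rewrite mulrC -ler_pdivrMr// mulrC -lee_fin EFinM.
  by rewrite !fineK ?fin_num_measure.
have PP0 : P `<< P0.
  apply/null_content_dominatesP => A mA A0; apply/eqP.
  by rewrite eq_le measure_ge0 andbT (le_trans (le1 _ mA))// A0 mule0.
have [h [h0 hfin ih Ph]] := radon_nikodym_sigma_finite PP0.
have d0 : is_density P0 P (fine \o h).
  split.
  - by apply/measurable_EFinP; apply: eq_measurable_fun (measurable_int _ ih) => x _;
      rewrite /= fineK.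
  - by move=> x; rewrite fine_ge0.
  - by move=> A mA; rewrite Ph//; apply: eq_integral => x _; rewrite /= fineK.
have d1 := density_min (ltW gm0) d0 le1.
have d2 : is_density P0 P _ := density_max (c := gamma^-1) _ d1 le2.
exists (fun x => Num.max (Num.min (fine (h x)) gamma) gamma^-1); split.
  by apply: d2; rewrite invr_ge0 ltW.
move=> x; rewrite le_max lexx orbT/= ge_max ge_min lexx orbT/=.
by rewrite (le_trans _ g1)// invf_le1.
Qed.

End Df_bounds.

(** * Partitioning an atomless distribution *)

Lemma probability_of_density d (T : measurableType d) (R : realType)
    (mu : {measure set T -> \bar R}) (g : T -> R) :
  measurable_fun setT g -> (forall x, 0 <= g x) -> (\int[mu]_x (g x)%:E = 1)%E ->
  exists P : probability T R,
    forall A, measurable A -> P A = (\int[mu]_(x in A) (g x)%:E)%E.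
Proof.
move=> mg g0 g1.
pose m (A : set T) := (\int[mu]_(x in A) (g x)%:E)%E.
have m0 : m set0 = 0%E by rewrite /m integral_set0.
have m_ge0 A : (0 <= m A)%E by apply: integral_ge0 => x _; rewrite lee_fin.
have m_sigma : semi_sigma_additive m.
  move=> /= F mF tF mUF; rewrite /m; apply: cvg_toP.
    apply: ereal_nondecreasing_is_cvgn => i j ij.
    by apply: lee_sum_nneg_natr => // k _ _; exact: m_ge0.
  rewrite ge0_integral_bigcup//=.
  - by apply/measurable_funTS/measurable_EFinP.
  - by move=> x _; rewrite lee_fin.
pose M : {measure set T -> \bar R} :=
  HB.pack m (isMeasure.Build d T R m m0 m_ge0 m_sigma).
pose P : probability T R := HB.pack m M (Measure_isProbability.Build d T R M g1).
by exists P.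
Qed.

Section atomless.
Context d (T : measurableType d) (R : realType) (P : probability T R) (X : T -> R).
Hypotheses (mX : measurable_fun setT X)
  (X_atomless : forall t, P [set x | X x = t] = 0%E).

Let Xrv : {RV P >-> R} := HB.pack X (isMeasurableFun.Build _ _ _ _ X mX).

(** The set is the sublevel set of [X] at a [c]-quantile. Being a lower set for [X] is recorded
    because it makes such sets nested. *)
Lemma lower_set_of_mass (c : R) : 0 <= c <= 1 ->
  exists B, [/\ measurable B, P B = c%:E & forall x y, B x -> X y <= X x -> B y].
Proof.
move=> /andP[]; rewrite le_eqVlt => /orP[/eqP <- _|c0].
  by exists set0; split => //; rewrite measure0.
rewrite le_eqVlt => /orP[/eqP ->|c1].
  by exists setT; split => //; rewrite probability_setT.
pose F (t : R) := P [set x | X x <= t].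
have FE t : F t = cdf Xrv t.
  by rewrite /F /cdf /distribution/= /pushforward; congr (P _); apply/seteqP; split => x;
    rewrite /= in_itv/=.
have mF t : measurable [set x | X x <= t].
  by rewrite -[X in measurable X]setTI; exact: measurable_fun_ler.
have ndF s t : s <= t -> (F s <= F t)%E.
  by move=> st; rewrite !FE; exact: cdf_nondecreasing.
pose S := [set t | (F t <= c%:E)%E].
(* With [c] strictly between 0 and 1, the limits of the distribution function at both infinities
   make [S] nonempty and bounded above. *)
have [lo Slo] : exists lo, S lo.
  apply: contrapT => /forallNP H.
  have : (c%:E <= 0)%E.
    apply: cvge_ge (cvg_cdfNy0 Xrv); apply: nearW => t; rewrite -FE.
    by have /negP := H t; rewrite -ltNge => /ltW.
  by rewrite lee_fin; lra.
have [hi Shi] : exists hi, (c%:E < F hi)%E.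
  apply: contrapT => /forallNP H.
  have : (1 <= c%:E)%E.
    apply: cvge_le (cvg_cdfy1 Xrv); apply: nearW => t; rewrite -FE.
    by have /negP := H t; rewrite -leNgt.
  by rewrite lee_fin; lra.
have hS : has_sup S.
  split; first by exists lo.
  exists hi => t St; rewrite leNgt; apply/negP => /ltW/ndF; rewrite leNgt => /negP; apply.
  exact: le_lt_trans St Shi.
pose t0 := sup S.
have t0_ge : (c%:E <= F t0)%E.
  rewrite FE.
  (* To the right of [t0] the distribution function exceeds [c]; right continuity carries this to
     [t0]. *)
  have cF : cdf Xrv t @[t --> t0^'+] --> cdf Xrv t0.
    exact: (@cdf_right_continuous _ _ _ P Xrv t0).
  apply: cvge_ge cF.
  near=> t; rewrite -FE leNgt; apply/negP => /ltW St.
  have : t <= t0 by exact: sup_upper_bound.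
  by apply/negP; rewrite -ltNge; near: t; exact: nbhs_right_gt.
have t0_le : (F t0 <= c%:E)%E.
  have mlt : measurable [set x | X x < t0].
    by rewrite -[X in measurable X]setTI; exact: measurable_fun_ltr.
  have meq : measurable [set x | X x = t0].
    by rewrite -[X in measurable X]setTI; exact: (mX measurableT (measurable_set1 t0)).
  have -> : F t0 = P [set x | X x < t0].
    rewrite /F (_ : [set x | X x <= t0] = [set x | X x < t0] `|` [set x | X x = t0]).
      rewrite measureU//; first by rewrite -[RHS]adde0; congr (_ + _)%E; exact: X_atomless.
      by rewrite -subset0 => x [/= xt xe]; rewrite xe ltxx in xt.
    apply/seteqP; split => x /=; first by rewrite le_eqVlt => /orP[/eqP|]; tauto.
    by case=> [/ltW//|->].
  (* Atomlessness reduces [F t0] to the mass of the open half-line, which these sublevel sets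
     exhaust, each of mass at most [c]. *)
  pose G k := [set x | X x <= t0 - k.+1%:R^-1].
  have GU : \bigcup_k G k = [set x | X x < t0].
    apply/seteqP; split => x /=.
      by case=> k _; rewrite /G/= => /le_lt_trans; apply; rewrite ltrBlDr ltrDl invr_gt0.
    move=> xt; have xt' : 0 < t0 - X x by rewrite subr_gt0.
    exists (Num.truncn (t0 - X x)^-1) => //; rewrite /G/= lerBrDr addrC -lerBrDr.
    rewrite -[leRHS]invrK lef_pV2 ?posrE ?invr_gt0//.
    by apply: ltW; exact: truncnS_gt.
  have cG : P (G k) @[k --> \oo] --> P [set x | X x < t0].
    rewrite -GU; apply: nondecreasing_cvg_mu.
    - by move=> k; exact: mF.
    - by rewrite GU.
    - move=> i j ij; apply/subsetPset => x; rewrite /G/= => /le_trans; apply.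
      by rewrite lerD2l lerN2 lef_pV2 ?posrE// ler_nat.
  apply: cvge_le cG; apply: nearW => k.
  have [s Ss ts] : exists2 s, S s & t0 - k.+1%:R^-1 < s.
    by apply: sup_adherent => //; rewrite invr_gt0.
  exact: le_trans (ndF _ _ (ltW ts)) Ss.
exists [set x | X x <= t0]; split; first exact: mF.
  by apply/eqP; rewrite eq_le; apply/andP.
by move=> x y /= xt yx; exact: le_trans xt.
Unshelve. all: by end_near. Qed.

(** The cells are successive differences of nested lower sets of masses [i / (m + 1)]. *)
Lemma equipartition (m : nat) : exists A : 'I_m.+1 -> set T,
  [/\ forall i, measurable (A i), trivIset setT A &
      forall i, P (A i) = (m.+1%:R^-1)%:E].
Proof.
have /choice[B hB] (i : nat) : exists B, (i <= m.+1)%N -> [/\ measurable B,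
    P B = (i%:R / m.+1%:R)%:E & forall x y, B x -> X y <= X x -> B y].
  case: (leqP i m.+1) => im; last by exists set0.
  have [|B hB] := @lower_set_of_mass (i%:R / m.+1%:R); last by exists B.
  by rewrite divr_ge0//= ler_pdivrMr// mul1r ler_nat.
have Bsub i j : (i <= j <= m.+1)%N -> B i `<=` B j.
  case/andP; rewrite leq_eqVlt => /orP[/eqP -> _|ij jm]; first exact: subset_refl.
  have [mj Pj lj] := hB j jm; have [mi Pi li] := hB i (leq_trans (ltnW ij) jm).
  (* A point of [B i] outside [B j] would place the lower set [B j] inside [B i], although [B j] has
     the larger mass. *)
  apply: contrapT => /existsNP[x /not_implyP[Bix nBjx]].
  have : (P (B j) <= P (B i))%E.
    apply: le_measure; rewrite ?inE// => y Bjy.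
    have [xy|yx] := leP (X x) (X y); first by have := lj _ _ Bjy xy.
    exact: li Bix (ltW yx).
  by rewrite Pi Pj lee_fin ler_pM2r ?invr_gt0// ler_nat leqNgt ij.
exists (fun i => B i.+1 `\` B i); split.
- move=> i; have [mj _ _] := hB i.+1 (ltn_ord i).
  by have [mi _ _] := hB i (ltnW (ltn_ord i)); exact: measurableD.
- apply/trivIsetP => i j _ _ ij; rewrite -subset0 => x [/= [Bi1 nBi] [Bj1 nBj]].
  case: (ltngtP i j) => [lt|lt|/val_inj eqij]; last by rewrite eqij eqxx in ij.
  + by apply: nBj; apply: Bsub Bi1; rewrite lt/= ltnW.
  + by apply: nBi; apply: Bsub Bj1; rewrite lt/= ltnW.
- move=> i; have [mj Pj _] := hB i.+1 (ltn_ord i).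
  have [mi Pi _] := hB i (ltnW (ltn_ord i)).
  rewrite measureD//; last by rewrite ltey_eq fin_num_measure.
  rewrite setIidr; last by apply: Bsub; rewrite leqnSn/= ltn_ord.
  rewrite [LHS](_ : _ = (P (B i.+1) - P (B i))%E)// Pi Pj -EFinB; congr EFin.
  by rewrite -mulrBl -natrB// subSnn mul1r.
Qed.

Lemma sum_trivIset_le1 (m : nat) (A : 'I_m -> set T) (Q : probability T R) :
  (forall i, measurable (A i)) -> trivIset setT A -> \sum_(i < m) fine (Q (A i)) <= 1.
Proof.
move=> mA tA; rewrite -lee_fin -sumEFin.
rewrite (eq_bigr (fun i => Q (A i))); last by move=> i _; rewrite fineK// fin_num_measure.
have mU : measurable (\big[setU/set0]_(i < m) A i) by exact: bigsetU_measurable.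
by rewrite -measure_semi_additive_ord//; exact: probability_le1.
Qed.

End atomless.

Lemma lebesgue_tuple_hyperplane (R : realType) (n : nat)
    (lam : {measure set (n.+1.-tuple R) -> \bar R}) (t : R) :
  is_lebesgue_tuple lam -> lam [set x | tnth x ord0 = t] = 0%E.
Proof.
move=> lamE.
pose box (a b : n.+1.-tuple R) := [set x : n.+1.-tuple R | forall i, tnth a i < tnth x i <= tnth b i].
have mbox a b : measurable (box a b).
  have -> : box a b = \bigcap_(i in [set: 'I_n.+1]) (@tnth n.+1 R ^~ i @^-1` `]tnth a i, tnth b i]).
    by apply/seteqP; split => x /= H i => [_|]; have := H i; rewrite /= in_itv/=; apply.
  apply: fin_bigcap_measurable => // i _; rewrite -[X in measurable X]setTI.
  exact: measurable_tnth.
pose H := [set x : n.+1.-tuple R | tnth x ord0 = t].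
have mH : measurable H.
  rewrite -[X in measurable X]setTI.
  exact: (@measurable_tnth _ R n.+1 ord0 measurableT _ (measurable_set1 t)).
pose cube (k : nat) := box [tuple - k%:R | i < n.+1] [tuple k%:R | i < n.+1].
have Hk0 k : lam (H `&` cube k) = 0%E.
  apply/eqP; rewrite eq_le measure_ge0 andbT; apply/lee_addgt0Pr => e e0; rewrite add0e.
  (* [C] is the volume of a face of the cube. A slab of thickness [e / (C + 1)] then has volume at
     most [e], also when [C] is 0. Boxes contain their upper faces, so the slab lies just below
     level [t]. *)
  pose C := (k%:R - (- k%:R)) ^+ n : R.
  have C0 : 0 <= C by rewrite exprn_ge0// opprK addr_ge0.
  pose de := e / (C + 1).
  have de0 : 0 < de by rewrite divr_gt0// ltr_wpDl.
  pose a := [tuple (if i == ord0 then t - de else - k%:R) | i < n.+1].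
  pose b := [tuple (if i == ord0 then t else k%:R) | i < n.+1].
  apply: (@le_trans _ _ (lam (box a b))).
    have mHc : measurable (H `&` cube k) by apply: measurableI => //; exact: mbox.
    apply: le_measure; [by rewrite inE|by rewrite inE; exact: mbox|].
    move=> x [/= xt xk] i; rewrite !tnth_mktuple; case: eqP => [->|_].
      by rewrite xt lexx andbT ltrBlDr ltrDl.
    by have := xk i; rewrite !tnth_mktuple.
  rewrite lamE; last first.
    move=> i; rewrite !tnth_mktuple; case: ifP => _; first by rewrite lerBlDr lerDl ltW.
    by rewrite -subr_ge0 opprK addr_ge0.
  rewrite lee_fin big_ord_recl !tnth_mktuple eqxx (eq_bigr (fun=> k%:R - (- k%:R))); last first.
    by move=> i _; rewrite !tnth_mktuple.
  rewrite prodr_const card_ord -/C opprB addrCA subrr addr0 /de.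
  by rewrite mulrAC ler_pdivrMr ?ltr_wpDl// ler_pM2l// lerDl.
have -> : [set x | tnth x ord0 = t] = \bigcup_k (H `&` cube k).
  apply/seteqP; split => x /=; last by case=> k _ [].
  move=> xt; pose M := \sum_(i < n.+1) `|tnth x i|.
  exists (Num.truncn M).+1 => //; split => // i; rewrite !tnth_mktuple.
  have : `|tnth x i| < (Num.truncn M).+1%:R.
    apply: le_lt_trans (truncnS_gt M); rewrite /M (bigD1 i)//= lerDl.
    by apply: sumr_ge0.
  by rewrite ltr_norml => /andP[-> /ltW].
apply/eqP; rewrite eq_le measure_ge0 andbT.
have mHk k : measurable (H `&` cube k) by apply: measurableI => //; exact: mbox.
apply: le_trans (measure_sigma_subadditive _ mHk _ _) _ => //.
  exact: bigcup_measurable.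
by rewrite eseries0.
Qed.

(** * Manipulating densities *)

Lemma clipZ (R : realType) (c x s1 s2 : R) : 0 <= c ->
  clip (c * x) (c * s1) (c * s2) = c * clip x s1 s2.
Proof. by move=> c0; rewrite /clip maxr_pMr// minr_pMr. Qed.

Lemma clip_le (R : realType) (x y s1 s2 : R) : x <= y -> clip x s1 s2 <= clip y s1 s2.
Proof.
move=> xy; rewrite /clip ge_max !le_max lexx/= le_min !ge_min lexx xy/=.
by rewrite orbT orbT.
Qed.

Lemma measurable_clip d (T : measurableType d) (R : realType) (h : T -> R) (s1 s2 : R) :
  measurable_fun setT h -> measurable_fun setT (fun x => clip (h x) s1 s2).
Proof.
move=> mh; apply: measurable_maxr; first exact: measurable_cst.
by apply: measurable_minr => //; exact: measurable_cst.
Qed.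

Section densities.
Context {R : realType} {n : nat}.
Local Notation T := (n.-tuple R).
Local Notation prob := (probability T R).
Implicit Types (mu : {measure set T -> \bar R}) (P Q : prob) (p q h : T -> R).

Lemma density_mul mu (P0 P : prob) p0 h : is_density mu P0 p0 ->
  is_density P0 P h -> is_density mu P (fun x => p0 x * h x).
Proof.
move=> [mp0 p00 P0E] [mh h0 PE]; split.
- exact: measurable_funM.
- by move=> x; rewrite mulr_ge0.
- by move=> A mA; rewrite PE//; exact: integral_density.
Qed.

Lemma density_div mu (P0 P : prob) p0 h : is_density mu P0 p0 ->
  measurable_fun setT h -> (forall x, 0 <= h x) ->
  is_density mu P (fun x => p0 x * h x) -> is_density P0 P h.
Proof.
move=> [mp0 p00 P0E] mh h0 [_ _ PE]; split => // A mA.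
by rewrite PE//; apply/esym; exact: integral_density.
Qed.

Lemma le_density mu P Q p q (c : R) (A : set T) : 0 <= c ->
  is_density mu P p -> is_density mu Q q -> (forall x, p x <= c * q x) ->
  measurable A -> (P A <= c%:E * Q A)%E.
Proof.
move=> c0 [mp p0 PE] [mq q0 QE] pq mA; rewrite PE// QE//.
rewrite -ge0_integralZl//; last 2 first.
- by apply: measurable_funTS; exact/measurable_EFinP.
- by move=> x _; rewrite lee_fin.
apply: ge0_le_integral => //.
- by move=> x _; rewrite lee_fin.
- by apply: measurable_funTS; exact/measurable_EFinP.
- by apply: measurable_funTS; apply/measurable_EFinP; exact: measurable_funM.
- by move=> x _; rewrite -EFinM lee_fin.
Qed.

(** An excess of [q'] over [Q] on [A] could not be compensated on the complement, where [q'] is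
    again at least [q], while the total is at most 1. *)
Lemma density_of_le mu Q q q' : is_density mu Q q -> measurable_fun setT q' ->
  (forall x, q x <= q' x) -> (\int[mu]_x (q' x)%:E <= 1)%E -> is_density mu Q q'.
Proof.
move=> [mq q0 QE] mq' qq' i1.
have q'0 x : 0 <= q' x := le_trans (q0 x) (qq' x).
have le_int A : measurable A -> (Q A <= \int[mu]_(x in A) (q' x)%:E)%E.
  move=> mA; rewrite QE//; apply: ge0_le_integral => //.
  - by move=> x _; rewrite lee_fin.
  - by apply: measurable_funTS; exact/measurable_EFinP.
  - by apply: measurable_funTS; exact/measurable_EFinP.
  - by move=> x _; rewrite lee_fin.
split => // A mA; have mCA : measurable (~` A) by exact: measurableC.
apply/eqP; rewrite eq_le le_int//=.
have mE B : measurable_fun B (EFin \o q' : T -> \bar R).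
  by apply: measurable_funTS; exact/measurable_EFinP.
rewrite (integral_setIC mu measurableT mA (mE setT)) !setTI in i1.
have := le_trans (leeD (lexx _) (le_int _ mCA)) i1.
rewrite probability_setC// -[Q A]fineK ?fin_num_measure// -EFinB.
by rewrite -leeBrDr// -EFinB opprB addrCA subrr addr0.
Qed.

Lemma density_of_ge mu Q q q' : is_density mu Q q -> measurable_fun setT q' ->
  (forall x, 0 <= q' x <= q x) -> (1 <= \int[mu]_x (q' x)%:E)%E -> is_density mu Q q'.
Proof.
move=> [mq q0 QE] mq' qq' i1.
have q'0 x : 0 <= q' x by case/andP: (qq' x).
have le_int A : measurable A -> (\int[mu]_(x in A) (q' x)%:E <= Q A)%E.
  move=> mA; rewrite QE//; apply: ge0_le_integral => //.
  - by move=> x _; rewrite lee_fin.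
  - by apply: measurable_funTS; exact/measurable_EFinP.
  - by apply: measurable_funTS; exact/measurable_EFinP.
  - by move=> x _; rewrite lee_fin; case/andP: (qq' x).
split => // A mA; have mCA : measurable (~` A) by exact: measurableC.
apply/eqP; rewrite eq_le le_int//= andbT.
have mE B : measurable_fun B (EFin \o q' : T -> \bar R).
  by apply: measurable_funTS; exact/measurable_EFinP.
rewrite (integral_setIC mu measurableT mA (mE setT)) !setTI in i1.
have := le_trans i1 (leeD (lexx _) (le_int _ mCA)).
rewrite probability_setC// -[Q A]fineK ?fin_num_measure// -EFinB.
by rewrite -leeBlDr// -EFinB opprB addrCA subrr addr0.
Qed.

Lemma integral_two_valued P (A E : set T) (a c : R) : measurable A -> measurable E ->
  (\int[P]_(x in E) (if x \in A then a else c)%:E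
   = a%:E * P (E `&` A) + c%:E * P (E `&` ~` A))%E.
Proof.
move=> mA mE.
have m1 : measurable (E `&` A) by exact: measurableI.
have m2 : measurable (E `&` ~` A) by apply: measurableI => //; exact: measurableC.
rewrite (integral_setIC P mE mA); last first.
  apply: measurable_funTS; apply/measurable_EFinP.
  apply: measurable_fun_ifT => //.
  by apply: (measurable_fun_bool true); rewrite setTI preimage_mem_true.
congr (_ + _)%E; rewrite -integral_cst//; apply: eq_integral => x; rewrite inE => -[_ xA].
- by rewrite mem_set.
- by rewrite memNset.
Qed.

End densities.

(** * Upper bound for the clipped sampler *)

(** [f] lies below its chord at [h / k]; multiplying by [k] makes the bound affine in [(h, k)],
    ready for [Df_le]. *)
Lemma fdiv_chord (R : realType) (f : R -> R) (t1 t2 h k : R) :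
  fdiv_generator f -> 0 < t2 -> t2 < t1 -> 0 < h -> 0 < k -> t2 * k <= h <= t1 * k ->
  (fdiv_integrand f h k <= ((t1 * f t2 - t2 * f t1) / (t1 - t2) * k
                            + (f t1 - f t2) / (t1 - t2) * h)%:E)%E.
Proof.
move=> [cf _] t20 t21 h0 k0 /andP[hk1 hk2]; rewrite /fdiv_integrand k0 h0 lee_fin.
have t12 : 0 < t1 - t2 by lra.
pose l := (h / k - t2) / (t1 - t2).
have hk : h / k = l * t1 + (1 - l) * t2 by rewrite /l; field; rewrite !gt_eqF.
have l01 : 0 <= l <= 1.
  rewrite /l ler_pdivrMr// mul1r lerD2r ler_pdivrMr// hk2 andbT.
  by apply: divr_ge0; [rewrite subr_ge0 ler_pdivlMr|exact: ltW].
have := cf t1 t2 l (lt_trans t20 t21) t20 l01.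
rewrite -hk => fhk.
apply: le_trans (_ : k * (l * f t1 + (1 - l) * f t2) <= _); first by rewrite ler_pM2l.
rewrite le_eqVlt; apply/orP; left; apply/eqP; rewrite /l; field.
by rewrite !gt_eqF.
Qed.

Section extremal_value.
Context {R : realType}.
Variables (g e : R).
Hypotheses (g1 : 1 <= g) (e1 : 1 <= e) (eg : e < g ^+ 2).

(** Relative to [P0], the clipping levels are [b] and [b * e]. The ratios [t1] and [t2] are those of
    an extremal pair: [g] against [b * e], and [1 / g] against [b]. *)
Let b := (g + 1) / (g + e).
Let t1 := g * (g + e) / ((g + 1) * e).
Let t2 := (g + e) / (g * (g + 1)).

Let g0 : 0 < g. Proof. exact: lt_le_trans g1. Qed.
Let e0 : 0 < e. Proof. exact: lt_le_trans e1. Qed.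
Let g_gt1 : 1 < g. Proof.
rewrite lt_neqAle g1 andbT; apply/eqP => g1'.
by move: eg; rewrite -g1' expr1n ltNge e1.
Qed.
Let gp1 : 0 < g + 1. Proof. exact: addr_gt0. Qed.
Let gpe : 0 < g + e. Proof. exact: addr_gt0. Qed.
Let b0 : 0 < b. Proof. exact: divr_gt0. Qed.
Let t1E : t1 * (b * e) = g. Proof. by rewrite /t1 /b; field; rewrite !gt_eqF. Qed.
Let t2E : t2 * b = g^-1. Proof. by rewrite /t2 /b; field; rewrite !gt_eqF. Qed.
Let t2_gt0 : 0 < t2. Proof. by rewrite divr_gt0 ?mulr_gt0. Qed.
Let t1_gt0 : 0 < t1. Proof. by rewrite divr_gt0 ?mulr_gt0. Qed.
Let t21 : t2 < t1.
Proof.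
rewrite -subr_gt0.
have -> : t1 - t2 = (g + e) * (g ^+ 2 - e) / (g * (g + 1) * e).
  by rewrite /t1 /t2; field; rewrite !gt_eqF.
by rewrite divr_gt0 ?mulr_gt0 ?subr_gt0.
Qed.

(* The common value of the game: divergence between (g/(g+1), 1/(g+1)) and
   (e/(g+e), g/(g+e)). *)
Definition extremal_value (f : R -> R) : R :=
  e / (g + e) * f (g * (g + e) / ((g + 1) * e)) + g / (g + e) * f ((g + e) / (g * (g + 1))).

Lemma clip_ratio_bounds r h : t2 <= r <= t1 -> g^-1 <= h <= g ->
  t2 * clip (h / r) b (b * e) <= h <= t1 * clip (h / r) b (b * e).
Proof.
move=> /andP[r2 r1] /andP[h1 h2].
have r0 : 0 < r by exact: lt_le_trans r2.
have h0 : 0 < h by apply: lt_le_trans h1; rewrite invr_gt0.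
rewrite /clip; apply/andP; split.
- rewrite (maxr_pMr _ _ (ltW t2_gt0)) t2E ge_max h1/= (minr_pMr _ _ (ltW t2_gt0)).
  rewrite ge_min; apply/orP; right.
  by rewrite mulrCA ger_pMr// ler_pdivrMr// mul1r.
- rewrite (maxr_pMr _ _ (ltW t1_gt0)) le_max (minr_pMr _ _ (ltW t1_gt0)) t1E.
  rewrite le_min h2/=; apply/orP; right.
  by rewrite mulrCA ler_pMr// ler_pdivlMr// mul1r.
Qed.

(* [h |-> s0 + s1 * h] interpolates (1/g, b) and (g, b * e), and has mean 1 under any
   density h with values in [1/g, g]. *)
Let s1 := b * (e - 1) / (g - g^-1).
Let s0 := b - s1 / g.

Let g_ginv : 0 < g - g^-1.
Proof. by rewrite subr_gt0 (lt_trans _ g_gt1)// invf_lt1. Qed.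

Let g21 : 0 < g ^+ 2 - 1. Proof. by rewrite subr_gt0 expr_gt1 ?ltW. Qed.

Let s01 : s0 + s1 = 1.
Proof.
by rewrite /s0 /s1 /b; field; rewrite !gt_eqF.
Qed.

Let affE h : s0 + s1 * h = b + (h - g^-1) * s1.
Proof. by rewrite /s0; ring. Qed.

(** The ray [h / t1] meets the interpolant at [h = g] and is steeper since [e < g ^ 2], so it stays
    below. Hence normalizing by [t1] gives mass at most 1. *)
Lemma clip_t1_le h : g^-1 <= h <= g -> clip (h / t1) b (b * e) <= s0 + s1 * h.
Proof.
move=> /andP[h1 h2]; rewrite affE /clip ge_max ge_min; apply/andP; split.
  rewrite lerDl; apply: mulr_ge0; first by rewrite subr_ge0.
  by apply: divr_ge0; [apply: mulr_ge0; [exact: ltW|rewrite subr_ge0]|exact: ltW].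
apply/orP; right.
have -> : h / t1 = h * (b * e) / g.
  by rewrite -t1E; field; rewrite !gt_eqF// mulr_gt0.
rewrite -subr_ge0.
have -> : b + (h - g^-1) * s1 - h * (b * e) / g
    = (g - h) * (b * (g ^+ 2 - e)) / (g * (g ^+ 2 - 1)).
  by rewrite /s1; field; rewrite !gt_eqF.
apply: divr_ge0; last by apply: ltW; exact: mulr_gt0.
by apply: mulr_ge0; [rewrite subr_ge0|apply: ltW; rewrite mulr_gt0// subr_gt0].
Qed.

(** Here the steeper ray [h / t2] meets the interpolant at [h = 1 / g] and stays above it, so
    normalizing by [t2] gives mass at least 1. *)
Lemma clip_t2_ge h : g^-1 <= h <= g -> s0 + s1 * h <= clip (h / t2) b (b * e).
Proof.
move=> /andP[h1 h2]; rewrite affE /clip le_max le_min; apply/orP; right.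
apply/andP; split.
  rewrite -subr_ge0.
  have -> : b * e - (b + (h - g^-1) * s1) = (g - h) * (b * (e - 1)) * g / (g ^+ 2 - 1).
    by rewrite /s1; field; rewrite !gt_eqF.
  apply: divr_ge0; last exact: ltW.
  apply: mulr_ge0; last exact: ltW.
  apply: mulr_ge0; first by rewrite subr_ge0.
  by apply: mulr_ge0; [exact: ltW|rewrite subr_ge0].
have -> : h / t2 = h * b * g.
  by rewrite -[in RHS](invrK g) -t2E; field; rewrite !gt_eqF.
rewrite -subr_ge0.
have -> : h * b * g - (b + (h - g^-1) * s1)
    = (h - g^-1) * (b * (g ^+ 2 - e)) * g / (g ^+ 2 - 1).
  by rewrite /s1; field; rewrite !gt_eqF.
apply: divr_ge0; last exact: ltW.
apply: mulr_ge0; last exact: ltW.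
by apply: mulr_ge0; [rewrite subr_ge0|apply: ltW; rewrite mulr_gt0// subr_gt0].
Qed.

Context {n : nat}.
Local Notation T := (n.-tuple R).
Variables (P0 P Q : probability T R) (h : T -> R) (r : R).
Hypotheses (dP : is_density P0 P h) (hg : forall x, g^-1 <= h x <= g) (r0 : 0 < r)
  (dQ : is_density P0 Q (fun x => clip (h x / r) b (b * e))).

Let clip_gt0 x r' : 0 < clip (h x / r') b (b * e).
Proof. by rewrite /clip lt_max b0. Qed.

Let mclip r' : measurable_fun setT (fun x => clip (h x / r') b (b * e)).
Proof. by apply: measurable_clip; apply: measurable_funM => //; case: dP. Qed.

Let hdiv_le x r1 r2 : 0 < r1 -> r1 <= r2 -> h x / r2 <= h x / r1.
Proof.
move=> r10 r12; have h0 : 0 < h x.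
  by have /andP[+ _] := hg x; apply: lt_le_trans; rewrite invr_gt0.
by rewrite ler_pM2l// lef_pV2// posrE (lt_le_trans r10).
Qed.

Let int_aff : (\int[P0]_x (s0 * cst 1 x + s1 * h x)%:E = 1)%E.
Proof.
rewrite (integral_affine_density s0 s1 dP (density_id P0) measurableT).
by rewrite !probability_setT !mulr1 s01.
Qed.

(** The clipped function decreases in the normalizer. If [r] exceeds [t1], moving back to [t1]
    raises the function but keeps its mass at most 1, so it is still a density of [Q]; likewise for
    [r] below [t2]. *)
Lemma clip_density_normalize : exists2 r', t2 <= r' <= t1 &
  is_density P0 Q (fun x => clip (h x / r') b (b * e)).
Proof.
have [rt1|rt1] := leP r t1; last first.
  exists t1; first by rewrite ltW/=.
  apply: density_of_le dQ (mclip t1) _ _.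
    by move=> x; apply: clip_le; apply: hdiv_le => //; exact: ltW.
  rewrite -int_aff; apply: le_integral_pointwise => x.
  by rewrite lee_fin mulr1 clip_t1_le.
have [rt2|rt2] := leP t2 r; first by exists r => //; rewrite rt2.
exists t2; first by rewrite lexx ltW.
apply: density_of_ge dQ (mclip t2) _ _.
  move=> x; rewrite ltW//=; apply: clip_le; apply: hdiv_le => //; exact: ltW.
rewrite -[leLHS]int_aff; apply: le_integral_pointwise => x.
by rewrite lee_fin mulr1 clip_t2_ge.
Qed.

Lemma Df_clip_le (f : R -> R) : fdiv_generator f ->
  (Df f P Q <= (extremal_value f)%:E)%E.
Proof.
move=> gf; have [r' hr' dQ'] := clip_density_normalize.
(* The right side is the chord through [t2] and [t1] evaluated at 1, whose barycentric weights are
   [e / (g + e)] on [t1] and [g / (g + e)] on [t2]. *)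
have -> : extremal_value f = (t1 * f t2 - t2 * f t1) / (t1 - t2) + (f t1 - f t2) / (t1 - t2).
  rewrite /extremal_value -/t1 -/t2.
  have t12 : t1 - t2 != 0 by rewrite gt_eqF// subr_gt0.
  have -> : e / (g + e) = (1 - t2) / (t1 - t2).
    apply: (canRL (mulfK t12)); rewrite /t1 /t2; field; rewrite !gt_eqF//.
  have -> : g / (g + e) = (t1 - 1) / (t1 - t2).
    apply: (canRL (mulfK t12)); rewrite /t1 /t2; field; rewrite !gt_eqF//.
  by field; rewrite gt_eqF// subr_gt0.
apply: (Df_le dP dQ') => x; apply: fdiv_chord => //.
- by have /andP[+ _] := hg x; apply: lt_le_trans; rewrite invr_gt0.
- exact: clip_ratio_bounds.
Qed.

End extremal_value.

(** * Lower bound for private samplers *)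

(** Otherwise [Q ord0] gives more than [e / (m + e)] to its own cell and, by privacy, at least
    [1 / (m + e)] to each of the [m] others: more than 1 in total. *)
Lemma LDP_min_mass d (T : measurableType d) (R : realType) (m : nat) (e : R)
    (Q : 'I_m.+1 -> probability T R) (A : 'I_m.+1 -> set T) : 0 < e ->
  (forall i, measurable (A i)) -> trivIset setT A ->
  (forall i j B, measurable B -> (Q i B <= e%:E * Q j B)%E) ->
  exists i, fine (Q i (A i)) <= e / (m%:R + e).
Proof.
move=> e0 mA tA ldp; apply: contrapT => /forallNP H.
have me : 0 < m%:R + e by apply: ltr_wpDl.
have big i : e / (m%:R + e) < fine (Q i (A i)) by rewrite ltNge; apply/negP; exact: H.
have := sum_trivIset_le1 (Q ord0) mA tA; apply/negP; rewrite -ltNge big_ord_recl.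
have -> : 1 = e / (m%:R + e) + m%:R / (m%:R + e) by field; rewrite gt_eqF.
apply: ltr_leD; first exact: big.
have Q0 i : (m%:R + e)^-1 <= fine (Q ord0 (A i)).
  rewrite -(ler_pM2l e0) (le_trans (ltW (big i)))// -lee_fin EFinM.
  by rewrite !fineK ?fin_num_measure//; exact: ldp.
rewrite mulr_natl -[X in _ *+ X]card_ord -sumr_const.
by apply: ler_sum => i _; exact: Q0.
Qed.

Section lower_bound.
Context {R : realType} {n : nat}.
Local Notation T := (n.-tuple R).
Local Notation prob := (probability T R).

(** The density [m] on [A] and [1 / m] elsewhere has mass 1 exactly because [A] has mass
    [1 / (m + 1)]. *)
Lemma Ngamma_two_valued (m : nat) (P0 : prob) (A : set T) : (0 < m)%N ->
  measurable A -> P0 A = (m.+1%:R^-1)%:E ->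
  exists2 P, Ngamma m%:R P0 P & P A = (m%:R / (m%:R + 1))%:E.
Proof.
move=> m0 mA PA; have m1 : 1 <= m%:R :> R by rewrite ler1n.
have gm0 : 0 < m%:R :> R by rewrite ltr0n.
have gm1 : 0 < m%:R + 1 :> R by exact: addr_gt0.
pose h x : R := if x \in A then m%:R else m%:R^-1.
have hg x : m%:R^-1 <= h x <= m%:R.
  have minv : m%:R^-1 <= m%:R :> R by rewrite (le_trans _ m1)// invf_le1.
  by rewrite /h; case: ifP => _; rewrite minv lexx.
have h0 x : 0 <= h x by have /andP[+ _] := hg x; apply: le_trans; rewrite invr_ge0.
have mh : measurable_fun setT h.
  apply: measurable_fun_ifT => //.
  by apply: (measurable_fun_bool true); rewrite setTI preimage_mem_true.
have h1 : (\int[P0]_x (h x)%:E = 1)%E.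
  rewrite integral_two_valued// !setTI probability_setC// PA -EFinB -!EFinM -EFinD.
  by congr EFin; rewrite -natr1; field; rewrite !gt_eqF.
have [P PE] := probability_of_density mh h0 h1.
have dP : is_density P0 P h by split.
exists P; first exact: Ngamma_density m1 dP hg.
by rewrite PE// integral_two_valued// setIid setICr measure0 mule0 adde0 PA -EFinM -natr1.
Qed.

(** With tangents at [t1] on [A] and at [t2] off [A], the bound of [Df_ge] is affine in [Q A],
    nonincreasing, and equal to the extremal value at [e / (g + e)]. *)
Lemma extremal_value_le_Df (g e : R) (f : R -> R) (P Q : prob) (A : set T) :
  1 <= g -> 1 <= e -> e < g ^+ 2 -> fdiv_generator f -> measurable A ->
  P A = (g / (g + 1))%:E -> fine (Q A) <= e / (g + e) ->
  ((extremal_value g e f)%:E <= Df f P Q)%E.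
Proof.
move=> g1 e1 eg gf mA PA QA.
have g0 : 0 < g by exact: lt_le_trans g1.
have e0 : 0 < e by exact: lt_le_trans e1.
have gp1 : 0 < g + 1 by exact: addr_gt0.
have gpe : 0 < g + e by exact: addr_gt0.
rewrite /extremal_value; set t1 := g * _ / _; set t2 := (g + e) / _.
have t1_gt0 : 0 < t1 by rewrite divr_gt0 ?mulr_gt0.
have t2_gt0 : 0 < t2 by rewrite divr_gt0 ?mulr_gt0.
have t21 : 0 < t1 - t2.
  have -> : t1 - t2 = (g + e) * (g ^+ 2 - e) / (g * (g + 1) * e).
    by rewrite /t1 /t2; field; rewrite !gt_eqF.
  by rewrite divr_gt0 ?mulr_gt0 ?subr_gt0.
have [s1 h1] := fdiv_generator_tangent gf t1_gt0.
have [s2 h2] := fdiv_generator_tangent gf t2_gt0.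
pose a1 := f t1 - s1 * t1; pose a2 := f t2 - s2 * t2.
(* Tangent slopes of a convex function increase, so the intercepts at 0 decrease. *)
have a12 : a1 <= a2.
  have H1 := h1 _ t2_gt0; have H2 := h2 _ t1_gt0.
  have : 0 <= (s1 - s2) * (t1 - t2) by lra.
  rewrite pmulr_lge0// => s12.
  have : 0 <= (s1 - s2) * t2 by rewrite mulr_ge0// ltW.
  rewrite /a1 /a2; lra.
have H := @Df_ge _ _ f P Q A a1 s1 a2 s2 gf mA _ _.
apply: le_trans (H _ _) => {H}; last 2 first.
- by move=> t t0; have := h1 t t0; rewrite /a1; lra.
- by move=> t t0; have := h2 t t0; rewrite /a2; lra.
rewrite !probability_setC// PA -[Q A]fineK ?fin_num_measure// -!EFinB/= lee_fin.
set x := fine (Q A) in QA *; set y := e / (g + e) in QA *.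
have -> : g / (g + e) = 1 - y by rewrite /y; field; rewrite gt_eqF.
have -> : g / (g + 1) = t1 * y by rewrite /t1 /y; field; rewrite !gt_eqF.
have -> : 1 - t1 * y = t2 * (1 - y).
  by rewrite /t1 /t2 /y; field; rewrite !gt_eqF.
have : 0 <= (a2 - a1) * (y - x) by rewrite mulr_ge0// subr_ge0.
rewrite /a1 /a2; lra.
Qed.

Lemma minimax_lower_bound (m : nat) (e : R) (P0 : prob) (X : T -> R) (f : R -> R)
    (Q : prob -> prob) :
  (0 < m)%N -> 1 <= e -> e < m%:R ^+ 2 -> fdiv_generator f ->
  measurable_fun setT X -> (forall t, P0 [set x | X x = t] = 0%E) ->
  (forall P P', Ngamma m%:R P0 P -> Ngamma m%:R P0 P' -> forall A, measurable A ->
     (Q P A <= e%:E * Q P' A)%E) ->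
  exists2 P, Ngamma m%:R P0 P & ((extremal_value m%:R e f)%:E <= Df f P (Q P))%E.
Proof.
move=> m0 e1 em gf mX X0 ldp.
have [A [mA tA PA]] := equipartition mX X0 m.
have /choice[P hP] (i : 'I_m.+1) : exists P, Ngamma m%:R P0 P /\
    P (A i) = (m%:R / (m%:R + 1))%:E.
  by have [P ? ?] := Ngamma_two_valued m0 (mA i) (PA i); exists P.
have [|i Qi] := @LDP_min_mass _ _ _ m e (Q \o P) A (lt_le_trans ltr01 e1) mA tA.
  by move=> i j B mB; exact: ldp (hP i).1 (hP j).1 _ mB.
exists (P i); first exact: (hP i).1.
apply: extremal_value_le_Df (mA i) (hP i).2 Qi => //.
by rewrite ler1n.
Qed.

End lower_bound.

(** * Optimality *)

(** In dimension 0 the space is a single point and has no atomless coordinate, so this case is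
    settled separately. *)
Lemma probability_tuple0 (R : realType) (P Q : probability (0.-tuple R) R)
  (A : set (0.-tuple R)) : P A = Q A.
Proof.
have [->|/set0P[x Ax]] := eqVneq A set0; first by rewrite !measure0.
have -> : A = setT by apply/seteqP; split => // y _; rewrite (tuple0 y) -(tuple0 x).
by rewrite !probability_setT.
Qed.

Section clipping_sampler.
Context {R : realType} {n : nat}.
Local Notation T := (n.-tuple R).
Local Notation prob := (probability T R).

Lemma density_atomless_coord (m : nat) (lam : {measure set (m.+1.-tuple R) -> \bar R})
    (P0 : probability (m.+1.-tuple R) R) (p0 : m.+1.-tuple R -> R) (t : R) :
  is_lebesgue_tuple lam -> is_density lam P0 p0 ->
  P0 [set x | tnth x ord0 = t] = 0%E.
Proof.
move=> hlam [mp0 _ P0E].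
have mH : measurable [set x : m.+1.-tuple R | tnth x ord0 = t].
  rewrite -[X in measurable X]setTI.
  exact: (@measurable_tnth _ R m.+1 ord0 measurableT _ (measurable_set1 t)).
rewrite P0E//; apply: null_set_integral => //.
  by apply: measurable_funTS; exact/measurable_EFinP.
exact: lebesgue_tuple_hyperplane.
Qed.

(** Clipping is homogeneous under nonnegative factors, so [p0] comes out of the clip, even where it
    is 0, and what remains is a density over [P0]. *)
Lemma clip_density (g e r : R) (lam : {measure set T -> \bar R}) (P0 Q : prob)
    (p0 h : T -> R) : 0 < g -> 0 < e ->
  is_density lam P0 p0 -> measurable_fun setT h ->
  is_density lam Q (fun x => clip (p0 x * h x / r)
    ((g + 1) / (g + e) * p0 x) ((g + 1) * e / (g + e) * p0 x)) ->
  is_density P0 Q (fun x => clip (h x / r) ((g + 1) / (g + e)) ((g + 1) / (g + e) * e)).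
Proof.
move=> g0 e0 dP0 mh dQ; have [_ p00 _] := dP0; apply: density_div dP0 _ _ _.
- by apply: measurable_clip; exact: measurable_funM.
- move=> x; rewrite /clip le_max; apply/orP; left.
  by apply: divr_ge0; apply: addr_ge0 => //; exact: ltW.
- congr (is_density _ _ _) : dQ; apply/funext => x.
  rewrite -clipZ//.
  by congr clip; [rewrite mulrA|rewrite mulrC|rewrite mulrC; congr (_ * _); rewrite mulrAC].
Qed.

Lemma clip_large_budget (g e r : R) (P0 P Q : prob) (h : T -> R) (f : R -> R) :
  1 <= g -> g ^+ 2 <= e -> 0 < r -> is_density P0 P h ->
  (forall x, g^-1 <= h x <= g) ->
  is_density P0 Q (fun x => clip (h x / r) ((g + 1) / (g + e)) ((g + 1) / (g + e) * e)) ->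
  fdiv_generator f -> (Df f P Q <= 0)%E.
Proof.
move=> g1 ge r0 dP hg dQ [_ f1].
have g0 : 0 < g by exact: lt_le_trans g1.
have e0 : 0 < e by apply: lt_le_trans ge; exact: exprn_gt0.
have gpe : 0 < g + e by exact: addr_gt0.
have h0 x : 0 < h x by have /andP[+ _] := hg x; apply: lt_le_trans; rewrite invr_gt0.
have h_id x : clip (h x) ((g + 1) / (g + e)) ((g + 1) / (g + e) * e) = h x.
  have /andP[h1 h2] := hg x; rewrite /clip min_r ?max_r//.
  - apply: le_trans h1; rewrite ler_pdivrMr// mulrC ler_pdivlMr//; nra.
  - by apply: (le_trans h2); rewrite mulrAC ler_pdivlMr//; nra.
have [mh _ _] := dP.
have iP : (\int[P0]_x (h x)%:E = 1)%E.
  by case: dP => _ _ /(_ setT measurableT) <-; rewrite probability_setT.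
(* The given [r] need not be 1. The clip of [h / r] is still comparable with [h] at every point, in
   a direction fixed by [r], and equal masses make [h] a density of [Q] too. *)
have dQh : is_density P0 Q h.
  have [r1|r1] := leP 1 r.
    apply: density_of_le dQ mh _ _; last by rewrite iP.
    move=> x; rewrite -[leRHS]h_id; apply: clip_le.
    by rewrite ler_pdivrMr// ler_peMr// ltW.
  apply: density_of_ge dQ mh _ _; last by rewrite iP.
  move=> x; rewrite ltW//= -[leLHS]h_id; apply: clip_le.
  by rewrite ler_pdivlMr// ger_pMr// ltW.
have <- : (0 + 0 : R)%:E = 0%E by rewrite addr0.
apply: (Df_le dP dQh) => x.
by rewrite /fdiv_integrand h0 divff ?gt_eqF// f1 mulr0 !mul0r addr0.
Qed.

End clipping_sampler.

Theorem theorem5 (R : realType) (n : nat) (gamma : nat)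
  (lam : {measure set (n.-tuple R) -> \bar R})
  (P0 : probability (n.-tuple R) R) (p0 : n.-tuple R -> R) (eps : R)
  (Pt : set (probability (n.-tuple R) R)) (f : R -> R)
  (Qs : probability (n.-tuple R) R -> probability (n.-tuple R) R) :
  (0 < gamma)%N ->
  is_lebesgue_tuple lam ->
  is_density lam P0 p0 ->
  0 <= eps ->
  Ngamma gamma%:R P0 `<=` Pt ->
  fdiv_generator f ->
  (* on N_gamma(P0), Qs is Q*_eps *)
  (forall P, Ngamma gamma%:R P0 P -> forall p, is_density lam P p ->
     exists r : R, 0 < r /\
       is_density lam (Qs P) (fun x => clip (p x / r)
          ((gamma%:R + 1) / (gamma%:R + expR eps) * p0 x)
          ((gamma%:R + 1) * expR eps / (gamma%:R + expR eps) * p0 x))) ->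
  (* off N_gamma(P0), Qs P = Q*_eps(Phat) with Phat a D_f-projection on N_gamma(P0) *)
  (forall P, Pt P -> ~ Ngamma gamma%:R P0 P ->
     exists Phat, [/\ Ngamma gamma%:R P0 Phat,
       (forall P', Ngamma gamma%:R P0 P' -> (Df f P Phat <= Df f P P')%E) &
       forall A, measurable A -> Qs P A = Qs Phat A]) ->
  is_LDP_sampler Pt eps Qs /\
  ereal_sup [set Df f P (Qs P) | P in Ngamma gamma%:R P0]
    = minimax_risk Pt eps (Ngamma gamma%:R P0) f.
Proof.
move=> gamma0 hlam dP0 eps0 NPt gf QsN QsO.
set g : R := gamma%:R in NPt QsN QsO *; set e := expR eps in QsN *.
have g1 : 1 <= g by rewrite /g ler1n.
have g0 : 0 < g by exact: lt_le_trans g1.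
have e1 : 1 <= e by rewrite /e -expR0 ler_expR.
have e0 : 0 < e by exact: lt_le_trans e1.
have b0 : 0 < (g + 1) / (g + e) by rewrite divr_gt0 ?addr_gt0.
have QsE P : Ngamma g P0 P -> exists h r, [/\ is_density P0 P h,
    (forall x, g^-1 <= h x <= g), 0 < r & is_density P0 (Qs P)
      (fun x => clip (h x / r) ((g + 1) / (g + e)) ((g + 1) / (g + e) * e))].
  move=> NP; have [h [dP hg]] := Ngamma_density_ex g1 NP.
  have [r [r0 dQ]] := QsN P NP _ (density_mul dP0 dP).
  exists h, r; split => //; apply: clip_density g0 e0 dP0 _ dQ.
  by case: dP.
have ldpN P P' : Ngamma g P0 P -> Ngamma g P0 P' -> forall A, measurable A ->
    (Qs P A <= e%:E * Qs P' A)%E.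
  move=> /QsE[h [r [_ _ _ dQ]]] /QsE[h' [r' [_ _ _ dQ']]] A mA.
  apply: le_density (ltW e0) dQ dQ' _ mA => x.
  (* Both clipped densities take values between [b] and [b * e] with [b = (g + 1) / (g + e)], hence
     the factor [e]. *)
  apply: (@le_trans _ _ ((g + 1) / (g + e) * e)).
    by rewrite /clip ge_max ge_min lexx andbT ler_peMr// ltW.
  by rewrite mulrC ler_pM2l// /clip le_max lexx.
have projN P : Pt P -> exists2 P', Ngamma g P0 P' &
    forall A, measurable A -> Qs P A = Qs P' A.
  move=> PtP; have [NP|NP] := pselect (Ngamma g P0 P); first by exists P.
  by have [P' [NP' _ QP']] := QsO P PtP NP; exists P'.
have ldp : is_LDP_sampler Pt eps Qs.
  move=> P P' /projN[P1 N1 Q1] /projN[P2 N2 Q2] A mA.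
  by rewrite Q1// Q2//; exact: ldpN.
split => //; apply/eqP; rewrite eq_le; apply/andP; split; last first.
  by apply: ereal_inf_lbound; exists Qs.
apply: le_ereal_inf_tmp => _ [Q [ldpQ ->]].
apply: ge_ereal_sup => _ [P NP <-].
have sup_ge P' : Ngamma g P0 P' ->
    (Df f P' (Q P') <= ereal_sup [set Df f P (Q P) | P in Ngamma g P0])%E.
  by move=> NP'; apply: ereal_sup_ubound; exists P'.
have [h [r [dP hg r0 dQ]]] := QsE P NP.
have [eg|ge] := ltP e (g ^+ 2); last first.
  apply: (le_trans (clip_large_budget g1 ge r0 dP hg dQ gf)).
  exact: le_trans (Df_ge0 _ _ gf) (sup_ge _ NP).
(* For [n = 0] all samplers agree; otherwise the first coordinate serves as the atomless variable
   that cuts the space into cells. *)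
case: n => [|m] in lam P0 p0 Pt Qs hlam dP0 NPt QsN QsO QsE ldpN projN ldp Q ldpQ P NP
    sup_ge h dP hg dQ *.
  by rewrite (@eq_Df _ _ f P (Qs P) (Q P)) ?sup_ge// => A _; exact: probability_tuple0.
have [P' NP' leP'] := minimax_lower_bound gamma0 e1 eg gf (@measurable_tnth _ R m.+1 ord0)
  (fun t => density_atomless_coord t hlam dP0)
  (fun P P' NP NP' => ldpQ P P' (NPt P NP) (NPt P' NP')).
apply: le_trans (sup_ge _ NP'); apply: le_trans leP'.
exact: (Df_clip_le g1 e1 eg dP hg r0 dQ gf).
Qed.
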